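(* Let $e$ be an expression, $\rho$ an environment (partial map from variables to $\mathbb{D}$), $\Gamma$ a type environment (partial map from variables to types), $d\in\mathbb{D}$ and $A$ a type. Then: (1) if $d \in \mathcal{E}[\![e]\!]\rho$, then $\mathsf{typof}(\rho) \vdash e : \mathsf{typof}(d)$; and (2) if $\Gamma \vdash e : A$, then $\mathsf{eltof}(A) \in \mathcal{E}[\![e]\!]\,\mathsf{eltof}(\Gamma)$, where $\mathsf{typof}(\rho)(x) = \mathsf{typof}(\rho(x))$ and $\mathsf{eltof}(\Gamma)(x) = \mathsf{eltof}(\Gamma(x))$.
   Context: **Expressions.** $e ::= n \mid e\oplus e \mid x \mid \lambda x.\,e \mid e\;e \mid \mathbf{if}\,e\,\mathbf{then}\,e\,\mathbf{else}\,e$, with $n\in\mathbb{Z}$, $x$ a variable, and $\oplus\in\{+,\times,-,\ldots\}$ a total binary integer operation. **Domain.** $\mathbb{D}$ is inductively defined by $\mathbb{D}=\mathbb{Z}+\mathcal{P}_f(\mathbb{D}\times\mathbb{D})$ ($\mathcal{P}_f$ = finite subsets); $d$ ranges over $\mathbb{D}$, $t$ over finite subsets of $\mathbb{D}\times\mathbb{D}$ (''tables''). The order $\sqsubseteq$ on $\mathbb{D}$: $n\sqsubseteq n$ for integers; $t\sqsubseteq t'$ iff $t\subseteq t'$; nothing else. **Semantics.** For an environment $\rho$ (partial map from variables to $\mathbb{D}$), $\mathcal{E}[\![e]\!]\rho\subseteq\mathbb{D}$ is defined by recursion on $e$: - $\mathcal{E}[\![n]\!]\rho=\{n\}$; $\mathcal{E}[\![x]\!]\rho=\{d\mid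 d\sqsubseteq\rho(x)\}$ (empty if $\rho(x)$ is undefined); - $\mathcal{E}[\![e_1\oplus e_2]\!]\rho=\{n_1\oplus n_2\mid n_1\in\mathcal{E}[\![e_1]\!]\rho,\ n_2\in\mathcal{E}[\![e_2]\!]\rho,\ n_1,n_2\in\mathbb{Z}\}$; - $\mathcal{E}[\![\lambda x.e]\!]\rho=\{t\mid\forall(d,d')\in t.\ d'\in\mathcal{E}[\![e]\!]\rho(x{:=}d)\}$; - $\mathcal{E}[\![e_1\,e_2]\!]\rho=\{d\mid\exists t,d_1,d_1',d_2.\ t\in\mathcal{E}[\![e_1]\!]\rho,\ d_2\in\mathcal{E}[\![e_2]\!]\rho,\ (d_1,d_1')\in t,\ d_1\sqsubseteq d_2,\ d\sqsubseteq d_1'\}$; - $\mathcal{E}[\![\mathbf{if}\,e_1\,\mathbf{then}\,e_2\,\mathbf{else}\,e_3]\!]\rho=\{d\mid\exists n\in\mathbb{Z}.\ n\in\mathcal{E}[\![e_1]\!]\rho,\ (n\ne0\Rightarrow d\in\mathcal{E}[\![e_2]\!]\rho),\ (n=0\Rightarrow d\in\mathcal{E}[\![e_3]\!]\rho)\}$. **Types.** Function types $F,G,H ::= A\to B\mid F\wedge G\mid\top$; types $A,B,C ::= n\mid F$ (with $n\in\mathbb{Z}$ a singleton type). **Subtyping** $<:$ is the least relation with: $A<:A$; $A<:B,\ B<:C\Rightarrow A<:C$; $A\approx A',\ B\approx B'\Rightarrow A\to B<:A'\to B'$; $H<:F,\ H<:G\Rightarrow H<:F\wedge G$; $F\wedge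 G<:F$; $F\wedge G<:G$; $A\to B<:\top$. Here $A\approx B$ means $A<:B$ and $B<:A$. **Typing** $\Gamma\vdash e:A$ is inductively defined by: - $\Gamma\vdash n:n$; if $\Gamma\vdash e_1:n_1$ and $\Gamma\vdash e_2:n_2$ then $\Gamma\vdash e_1\oplus e_2:n_1\oplus n_2$; $\Gamma\vdash x:\Gamma(x)$ (for $x$ in the domain of $\Gamma$); - if $\Gamma,x{:}A\vdash e:B$ then $\Gamma\vdash\lambda x.e:A\to B$; $\Gamma\vdash\lambda x.e:\top$; if $\Gamma\vdash\lambda x.e:A$ and $\Gamma\vdash\lambda x.e:B$ (with $A,B$ function types) then $\Gamma\vdash\lambda x.e:A\wedge B$; - if $\Gamma\vdash e_1:A\to B$ and $\Gamma\vdash e_2:A$ then $\Gamma\vdash e_1\,e_2:B$; if $\Gamma\vdash e:A$ and $A<:B$ then $\Gamma\vdash e:B$; - if $\Gamma\vdash e_1:n$, $n\ne0$, $\Gamma\vdash e_2:B$ then $\Gamma\vdash\mathbf{if}\,e_1\,\mathbf{then}\,e_2\,\mathbf{else}\,e_3:B$; if $\Gamma\vdash e_1:n$, $n=0$, $\Gamma\vdash e_3:B$ then $\Gamma\vdash\mathbf{if}\,e_1\,\mathbf{then}\,e_2\,\mathbf{else}\,e_3:B$. **Translations.** $\mathsf{typof}:\mathbb{D}\to$ types: $\mathsf{typof}(n)=n$, $\mathsf{typof}(t)=\bigwedge_{(d,d')\in t}(\mathsf{typof}(d)\to\mathsf{typof}(d'))$, the finite conjunction being taken along some fixed enumeration of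 $t$ and ending in $\top$ (so $\mathsf{typof}(\emptyset)=\top$); the choice of enumeration is immaterial up to $\approx$. $\mathsf{eltof}$: types $\to\mathbb{D}$: $\mathsf{eltof}(n)=n$, $\mathsf{eltof}(A\to B)=\{(\mathsf{eltof}(A),\mathsf{eltof}(B))\}$, $\mathsf{eltof}(F\wedge G)=\mathsf{eltof}(F)\cup\mathsf{eltof}(G)$, $\mathsf{eltof}(\top)=\emptyset$. *)

(* Defs.v *)
From HB Require Import structures.
From mathcomp Require Import all_boot all_order all_algebra.
From mathcomp Require Import finmap.

Set Implicit Arguments.
Unset Strict Implicit.
Unset Printing Implicit Defensive.

Local Open Scope fset_scope.

Definition var := nat.

(* An operator is represented by the total binary function that it denotes, so
   that expressions range over all total binary integer operations. *)
Inductive expr :=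
| ENum of int
| EOp of (int -> int -> int) & expr & expr
| EVar of var
| ELam of var & expr
| EApp of expr & expr
| EIf of expr & expr & expr.

Definition env (T : Type) := var -> option T.

Definition upd (T : Type) (rho : env T) (x : var) (a : T) : env T :=
  fun y => if y == x then Some a else rho y.

(* The domain D = Z + P_f(D x D).  The constructor {fset _} is not strictly
   positive, so D cannot be declared as an inductive type directly.  It is
   carved out of the trees [raw]: a finite set is represented by the list of
   its elements that finmap uses to represent it, and [wf] requires this at
   every node.  Equality on the resulting type [dom] is thus extensional
   equality of (hereditarily) finite sets; see [rollK], [unrollK] and
   [dom_ind] for the characterization of [dom]. *)
Inductive raw := RNum of int | RTab of seq (raw * raw).

Fixpoint raw_enc (r : raw) : GenTree.tree int :=
  match r with
  | RNum n => GenTree.Leaf n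
  | RTab s => GenTree.Node 0
      (map (fun p => GenTree.Node 1 [:: raw_enc p.1; raw_enc p.2]) s)
  end.

Fixpoint raw_dec (u : GenTree.tree int) : raw :=
  match u with
  | GenTree.Leaf n => RNum n
  | GenTree.Node _ us => RTab (map (fun v =>
      if v is GenTree.Node _ [:: a; b] then (raw_dec a, raw_dec b)
      else (RNum 0, RNum 0)) us)
  end.

Fixpoint raw_ind2 (P : raw -> Prop) (Pnum : forall n, P (RNum n))
  (Ptab : forall s, foldr (fun p Q => (P p.1 /\ P p.2) /\ Q) True s ->
    P (RTab s)) (r : raw) : P r :=
  match r with
  | RNum n => Pnum n
  | RTab s => Ptab s
      ((fix aux (s : seq (raw * raw)) :
          foldr (fun p Q => (P p.1 /\ P p.2) /\ Q) True s :=
        match s with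
        | [::] => I
        | (a, b) :: s' =>
            conj (conj (raw_ind2 Pnum Ptab a) (raw_ind2 Pnum Ptab b)) (aux s')
        end) s)
  end.

Lemma raw_encK : cancel raw_enc raw_dec.
Proof.
elim/raw_ind2=> [//|s IH] /=; congr RTab.
elim: s IH => [//|[a b] s IHs] /= [[-> ->] /IHs IH].
by congr (_ :: _).
Qed.

HB.instance Definition _ := Countable.copy raw (can_type raw_encK).

Fixpoint wf (r : raw) : bool :=
  match r with
  | RNum _ => true
  | RTab s => (sort_keys s == s) && all (fun p => wf p.1 && wf p.2) s
  end.

Record dom := Dom { dom_val : raw; dom_wf : wf dom_val }.

HB.instance Definition _ := [isSub for dom_val].
HB.instance Definition _ := [Countable of dom by <:].

Notation table := {fset dom * dom}.

Definition dnum (n : int) : dom := @Dom (RNum n) isT.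

Definition raw_pair (p : dom * dom) : raw * raw := (val p.1, val p.2).

Definition raw_table (t : table) : {fset raw * raw} := raw_pair @` t.

Lemma wf_table (t : table) : wf (RTab (enum_fset (raw_table t))).
Proof.
rewrite /=; apply/andP; split; first by case: (raw_table t) => s /=.
apply/allP => p /imfsetP[q /= _ ->] /=.
by rewrite !(valP (_ : dom)).
Qed.

Definition dtab (t : table) : dom := Dom (wf_table t).

Definition dom_pair (p : raw * raw) : dom * dom :=
  (insubd (dnum 0) p.1, insubd (dnum 0) p.2).

Definition roll (u : int + table) : dom :=
  match u with inl n => dnum n | inr t => dtab t end.

Definition unroll (d : dom) : int + table :=
  match val d with
  | RNum n => inl n
  | RTab s => inr [fset dom_pair p | p in s]
  end.

Lemma raw_pairK : cancel raw_pair dom_pair.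
Proof. by case=> a b; rewrite /dom_pair /= !valKd. Qed.

Lemma rollK : cancel roll unroll.
Proof.
case=> [//|t]; rewrite /unroll /=; congr inr.
apply/fsetP => p; apply/imfsetP/idP => /= [[q] | pt].
  by case/imfsetP=> q' /= q't -> ->; rewrite raw_pairK.
by exists (raw_pair p); rewrite ?raw_pairK // in_imfset.
Qed.

Lemma unrollK : cancel unroll roll.
Proof.
case=> [[n|s]] Hr; rewrite /unroll /=; first exact: val_inj.
apply: val_inj => /=; congr RTab.
move: (Hr) => /= /andP[/eqP sS /allP wfs].
have pK p : p \in s -> raw_pair (dom_pair p) = p.
  by move=> /wfs /andP[w1 w2]; case: p w1 w2 => a b *; rewrite /raw_pair !insubdK.
have key (u : {fset raw * raw}) : sort_keys (enum_fset u) = enum_fset u.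
  by apply/eqP; case: u.
rewrite -[RHS]sS -key; apply/SortKeys.eq => p.
apply/imfsetP/idP => /= [[q] | ps].
  by case/imfsetP=> q' /= q's -> ->; rewrite pK.
exists (dom_pair p); rewrite ?pK //.
by apply/imfsetP; exists p.
Qed.

Lemma dom_ind (P : dom -> Prop) :
  (forall n, P (dnum n)) ->
  (forall t : table, (forall p, p \in t -> P p.1 /\ P p.2) -> P (dtab t)) ->
  forall d, P d.
Proof.
move=> Pn Pt [r]; elim/raw_ind2: r => [n|s IH] Hr.
  by rewrite (_ : Dom Hr = dnum n) //; apply: val_inj.
rewrite -[Dom Hr]unrollK; apply: Pt => p /imfsetP[q /= qs ->] {p}.
move: Hr => /= /andP[_ /allP /(_ q qs) /andP[w1 w2]].
elim: s qs IH => //= q' s IHs; rewrite inE => /orP[/eqP<- [[h1 h2] _]|qs [_]].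
  split; [move: (h1 w1)|move: (h2 w2)]; congr (P _); apply: val_inj;
    by rewrite insubdK.
exact: IHs.
Qed.

Inductive dle : dom -> dom -> Prop :=
| dle_num n : dle (dnum n) (dnum n)
| dle_tab (t t' : table) : t `<=` t' -> dle (dtab t) (dtab t').

(* [sem e rho d] is membership of d in the denotation of e in rho. *)
Fixpoint sem (e : expr) (rho : env dom) (d : dom) : Prop :=
  match e with
  | ENum n => d = dnum n
  | EOp op e1 e2 => exists n1 n2 : int,
      [/\ sem e1 rho (dnum n1), sem e2 rho (dnum n2) & d = dnum (op n1 n2)]
  | EVar x => exists2 d', rho x = Some d' & dle d d'
  | ELam x e1 => exists2 t : table, d = dtab t &
      forall d1 d1', (d1, d1') \in t -> sem e1 (upd rho x d1) d1'
  | EApp e1 e2 => exists (t : table) (d1 d1' d2 : dom),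
      [/\ sem e1 rho (dtab t), sem e2 rho d2, (d1, d1') \in t,
          dle d1 d2 & dle d d1']
  | EIf e1 e2 e3 => exists n : int,
      [/\ sem e1 rho (dnum n), n <> 0%R -> sem e2 rho d
        & n = 0%R -> sem e3 rho d]
  end.

Inductive fty :=
| TArr of ty & ty
| TAnd of fty & fty
| TTop
with ty :=
| TNum of int
| TFun of fty.

Coercion TFun : fty >-> ty.

Inductive subty : ty -> ty -> Prop :=
| sub_refl A : subty A A
| sub_trans A B C : subty A B -> subty B C -> subty A C
| sub_arr A A' B B' :
    (* type equivalence (mutual subtyping) of A, A' and of B, B', inlined *)
    subty A A' -> subty A' A -> subty B B' -> subty B' B ->
    subty (TArr A B) (TArr A' B')
| sub_and (F G H : fty) : subty H F -> subty H G -> subty H (TAnd F G)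
| sub_andl (F G : fty) : subty (TAnd F G) F
| sub_andr (F G : fty) : subty (TAnd F G) G
| sub_top A B : subty (TArr A B) TTop.

Inductive typing : env ty -> expr -> ty -> Prop :=
| ty_num Gamma n : typing Gamma (ENum n) (TNum n)
| ty_op Gamma op e1 e2 n1 n2 :
    typing Gamma e1 (TNum n1) -> typing Gamma e2 (TNum n2) ->
    typing Gamma (EOp op e1 e2) (TNum (op n1 n2))
| ty_var (Gamma : env ty) x A : Gamma x = Some A -> typing Gamma (EVar x) A
| ty_lam Gamma x e A B :
    typing (upd Gamma x A) e B -> typing Gamma (ELam x e) (TArr A B)
| ty_top Gamma x e : typing Gamma (ELam x e) TTop
| ty_and Gamma x e (F G : fty) :
    typing Gamma (ELam x e) F -> typing Gamma (ELam x e) G ->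
    typing Gamma (ELam x e) (TAnd F G)
| ty_app Gamma e1 e2 A B :
    typing Gamma e1 (TArr A B) -> typing Gamma e2 A ->
    typing Gamma (EApp e1 e2) B
| ty_sub Gamma e A B : typing Gamma e A -> subty A B -> typing Gamma e B
| ty_if_true Gamma e1 e2 e3 n B :
    typing Gamma e1 (TNum n) -> n <> 0%R -> typing Gamma e2 B ->
    typing Gamma (EIf e1 e2 e3) B
| ty_if_false Gamma e1 e2 e3 n B :
    typing Gamma e1 (TNum n) -> n = 0%R -> typing Gamma e3 B ->
    typing Gamma (EIf e1 e2 e3) B.

Fixpoint typof_raw (r : raw) : ty :=
  match r with
  | RNum n => TNum n
  | RTab s => foldr (fun p F => TAnd (TArr (typof_raw p.1) (typof_raw p.2)) F)
                    TTop s
  end.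

(* The conjunction follows the enumeration of t stored in the underlying tree,
   i.e. [enum_table t]; see [typof_dnum] and [typof_dtab]. *)
Definition typof (d : dom) : ty := typof_raw (val d).

Definition enum_table (t : table) : seq (dom * dom) :=
  map dom_pair (enum_fset (raw_table t)).

Lemma enum_table_perm (t : table) : perm_eq (enum_table t) (enum_fset t).
Proof.
have dK : {in enum_fset (raw_table t), cancel dom_pair raw_pair}.
  by move=> p /imfsetP[q /= _ ->]; rewrite raw_pairK.
apply: uniq_perm; rewrite ?fset_uniq //.
  by rewrite map_inj_in_uniq ?fset_uniq //; apply: can_in_inj dK.
move=> p; apply/mapP/idP => [[q /imfsetP[q' /= q't ->] ->]|pt].
  by rewrite raw_pairK.
by exists (raw_pair p); rewrite ?raw_pairK // in_imfset.
Qed.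

Lemma typof_dnum n : typof (dnum n) = TNum n.
Proof. by []. Qed.

Lemma typof_dtab (t : table) :
  typof (dtab t) =
  foldr (fun p F => TAnd (TArr (typof p.1) (typof p.2)) F) TTop (enum_table t).
Proof.
congr TFun; rewrite /enum_table foldr_map.
have: {subset enum_fset (raw_table t) <= raw_table t} by [].
elim: (enum_fset (raw_table t)) => [//|p s IHs] sub.
have [q ->] : exists q, p = raw_pair q.
  by have /imfsetP[q /= _ ->] := sub p (mem_head _ _); exists q.
have {}IHs := IHs (fun r rs => sub r (mem_behead (s := p :: s) rs)).
by rewrite /= IHs /typof !valKd.
Qed.

Fixpoint eltof (A : ty) : dom :=
  match A with
  | TNum n => dnum n
  | TFun F => dtab (eltof_fun F)
  end
with eltof_fun (F : fty) : table :=
  match F with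
  | TArr A B => [fset (eltof A, eltof B)]
  | TAnd F G => eltof_fun F `|` eltof_fun G
  | TTop => fset0
  end.

Definition typof_env (rho : env dom) : env ty := fun x => omap typof (rho x).

Definition eltof_env (Gamma : env ty) : env dom :=
  fun x => omap eltof (Gamma x).

(* Main.v *)
(** Both translations reverse the order: [d ⊑ d'] gives [typof d' <: typof d],
    and [A <: B] gives [eltof B ⊑ eltof A].  Hence (1) is an induction on [e] in
    which each use of [⊑] in the semantics becomes a subsumption, and (2) is an
    induction on the typing derivation in which subsumption becomes downward
    closure of denotations.  The invariant arrow rule causes no trouble in (2):
    [⊑] is antisymmetric, so equivalent types have the same [eltof]. *)

From mathcomp Require Import all_boot all_order all_algebra.
From mathcomp Require Import finmap.
From Stdlib Require Import FunctionalExtensionality.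
Require Import Defs.

Set Implicit Arguments.
Unset Strict Implicit.
Unset Printing Implicit Defensive.

Local Open Scope fset_scope.

(** [dtab] is a function into a carved-out type, not a constructor, so injectivity comes from the
    cancellation [rollK]. *)
Lemma dtab_inj : injective dtab.
Proof. by move=> t t' e; have [] := can_inj rollK (e : roll (inr t) = roll (inr t')). Qed.

Lemma dle_numr d n : dle d (dnum n) -> d = dnum n.
Proof. by move=> h; inversion h. Qed.

Lemma dle_tabr d t' : dle d (dtab t') -> exists2 t, d = dtab t & t `<=` t'.
Proof.
move e: (dtab t') => d' h; case: h e => [n //|t u tu /dtab_inj ->].
by exists t.
Qed.

Lemma dle_tabE t t' : dle (dtab t) (dtab t') -> t `<=` t'.
Proof. by case/dle_tabr => u /dtab_inj ->. Qed.

Lemma dle_refl d : dle d d.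
Proof.
by elim/dom_ind: d => [n|t _]; [apply: dle_num | apply/dle_tab/fsubset_refl].
Qed.

Lemma dle_trans d1 d2 d3 : dle d1 d2 -> dle d2 d3 -> dle d1 d3.
Proof.
move=> h12 h23; case: h23 h12 => [//|t t' tt' /dle_tabr[u -> ut]].
exact/dle_tab/(fsubset_trans ut).
Qed.

Lemma dle_antisym d d' : dle d d' -> dle d' d -> d = d'.
Proof.
case=> [//|t t' tt' /dle_tabE t't].
by congr dtab; apply/eqP; rewrite eqEfsubset tt'.
Qed.

(** Variables and applications are closed by transitivity of [dle], and a subtable of a valid table
    for a lambda has fewer entries to check; only the conditional calls on the induction
    hypotheses. *)
Lemma sem_closed e rho d d' : sem e rho d -> dle d' d -> sem e rho d'.
Proof.
elim: e rho d d' => [n|op e1 _ e2 _|x|x e IH|e1 _ e2 _|e1 _ e2 IH2 e3 IH3]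
  rho d d' /=.
- by move=> -> /dle_numr.
- by case=> n1 [n2 [h1 h2 ->]] /dle_numr->; exists n1, n2.
- by case=> d0 ex dd0 d'd; exists d0; last exact: dle_trans dd0.
- case=> t -> ht /dle_tabr[t' -> /fsubsetP t't]; exists t' => // d1 d1' /t't.
  exact: ht.
- case=> t [d1 [d1' [d2 [ht h2 h1 le1 le2]]]] d'd.
  by exists t, d1, d1', d2; split=> //; exact: dle_trans le2.
- case=> n [h1 h2 h3] d'd; exists n; split=> // hn.
    exact: IH2 (h2 hn) d'd.
  exact: IH3 (h3 hn) d'd.
Qed.

(** The rule [sub_top] covers arrows only; a conjunction reaches [TTop] through its left
    conjunct. *)
Lemma subty_top (F : fty) : subty F TTop.
Proof.
elim: F => [A B|F IHF G _|]; [exact: sub_top | | exact: sub_refl].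
exact: sub_trans (sub_andl F G) IHF.
Qed.

Lemma mem_enum_table t p : (p \in enum_table t) = (p \in t).
Proof. by rewrite (perm_mem (enum_table_perm t)). Qed.

Lemma typof_dtab_sub (t : table) d d' :
  (d, d') \in t -> subty (typof (dtab t)) (TArr (typof d) (typof d')).
Proof.
rewrite typof_dtab -mem_enum_table; elim: (enum_table t) => //= p s IH.
rewrite inE => /predU1P[<-|/IH]; first exact: sub_andl.
exact/sub_trans/sub_andr.
Qed.

(** With [typof_dtab_sub], this makes [typof (dtab t)] a greatest lower bound of the arrows of [t]
    among function types, whatever the enumeration. *)
Lemma sub_typof_dtab (F : fty) (t : table) :
  (forall d d', (d, d') \in t -> subty F (TArr (typof d) (typof d'))) ->
  subty F (typof (dtab t)).
Proof.
move=> Ft; have {}Ft p : p \in enum_table t ->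
    subty F (TArr (typof p.1) (typof p.2)).
  by rewrite mem_enum_table; case: p => d d' /Ft.
rewrite typof_dtab; elim: (enum_table t) Ft => /= [|p s IH] Ft.
  exact: subty_top.
apply: sub_and; first by apply: Ft; rewrite mem_head.
by apply: IH => q qs; apply: Ft; rewrite inE qs orbT.
Qed.

Lemma typing_typof_dtab Gamma x e (t : table) :
  (forall d d', (d, d') \in t ->
     typing Gamma (ELam x e) (TArr (typof d) (typof d'))) ->
  typing Gamma (ELam x e) (typof (dtab t)).
Proof.
move=> et; have {}et p : p \in enum_table t ->
    typing Gamma (ELam x e) (TArr (typof p.1) (typof p.2)).
  by rewrite mem_enum_table; case: p => d d' /et.
rewrite typof_dtab; elim: (enum_table t) et => /= [|p s IH] et.
  exact: ty_top.
apply: ty_and; first by apply: et; rewrite mem_head.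
by apply: IH => q qs; apply: et; rewrite inE qs orbT.
Qed.

Lemma typof_anti d d' : dle d d' -> subty (typof d') (typof d).
Proof.
case=> [n|t t' /fsubsetP tt']; first exact: sub_refl.
by apply: sub_typof_dtab => d1 d2 /tt'; apply: typof_dtab_sub.
Qed.

Lemma eltof_anti A B : subty A B -> dle (eltof B) (eltof A).
Proof.
elim=> {A B} [A|A B C _ BA _ CB|A A' B B' _ A'A _ AA' _ B'B _ BB'|F G H _ + _|
  F G|F G|A B] /=.
- exact: dle_refl.
- exact: dle_trans BA.
- by rewrite (dle_antisym A'A AA') (dle_antisym B'B BB'); apply: dle_refl.
- by move=> /dle_tabE FH /dle_tabE GH; apply/dle_tab; rewrite fsubUset FH.
- exact/dle_tab/fsubsetUl.
- exact/dle_tab/fsubsetUr.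
- exact/dle_tab/fsub0set.
Qed.

(** Lets both translations of environments pass under a binder in the lambda cases. *)
Lemma omap_upd (T U : Type) (f : T -> U) (rho : env T) x a :
  (fun y => omap f (upd rho x a y)) = upd (fun y => omap f (rho y)) x (f a).
Proof.
by apply: functional_extensionality => y; rewrite /upd; case: (y == x).
Qed.

Lemma sem_typing e rho d : sem e rho d -> typing (typof_env rho) e (typof d).
Proof.
elim: e rho d => [n|op e1 IH1 e2 IH2|x|x e IH|e1 IH1 e2 IH2|e1 IH1 e2 IH2 e3 IH3]
  rho d /=.
- by move=> ->; apply: ty_num.
- by case=> n1 [n2 [/IH1 h1 /IH2 h2 ->]]; apply: ty_op.
- case=> d' ex /typof_anti; apply/ty_sub/ty_var.
  by rewrite /typof_env ex.
- case=> t -> ht; apply: typing_typof_dtab => d1 d2 /ht/IH h.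
  by apply: ty_lam; rewrite /typof_env -omap_upd.
- case=> t [d1 [d1' [d2 [/IH1 h1 /IH2 h2 /typof_dtab_sub st]]]].
  (* Three subsumptions: the function gets the arrow type of its entry [(d1, d1')], the argument
     goes from [typof d2] to [typof d1], and the result from [typof d1'] to [typof d]. *)
  move=> /typof_anti s2 /typof_anti; apply: ty_sub.
  exact: ty_app (ty_sub h1 st) (ty_sub h2 s2).
- case=> n [/IH1 h1 h2 h3]; have [n0|/eqP n0] := eqVneq n 0%R.
    exact: ty_if_false h1 n0 (IH3 _ _ (h3 n0)).
  exact: ty_if_true h1 n0 (IH2 _ _ (h2 n0)).
Qed.

Lemma typing_sem Gamma e A :
  typing Gamma e A -> sem e (eltof_env Gamma) (eltof A).
Proof.
elim=> {Gamma e A} [//|Gamma op e1 e2 n1 n2 _ h1 _ h2|Gamma x A ex|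
  Gamma x e A B _ h|Gamma x e|Gamma x e F G _ [t et ht] _ [u eu hu]|
  Gamma e1 e2 A B _ h1 _ h2|Gamma e A B _ h /eltof_anti|
  Gamma e1 e2 e3 n B _ h1 n0 _ h2|Gamma e1 e2 e3 n B _ h1 n0 _ h3] /=.
- by exists n1, n2.
- by exists (eltof A); [rewrite /eltof_env ex | exact: dle_refl].
- exists [fset (eltof A, eltof B)] => // d d' /fset1P[-> ->].
  by rewrite /eltof_env -omap_upd.
- by exists fset0.
(* The tables [t] and [u] from the induction hypotheses are [eltof_fun F] and [eltof_fun G], by
   injectivity of [dtab]. *)
- exists (t `|` u).
    by rewrite -(dtab_inj et) -(dtab_inj eu).
  by move=> d d' /fsetUP[/ht|/hu].
(* The singleton table is the image of the arrow type, so its only entry matches the argument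
   exactly. *)
- exists [fset (eltof A, eltof B)], (eltof A), (eltof B), (eltof A).
  by split; rewrite ?fset11 //; apply: dle_refl.
- exact: sem_closed h.
- by exists n; split.
- by exists n; split.
Qed.

Theorem theorem1 (e : expr) (rho : env dom) (Gamma : env ty) (d : dom)
    (A : ty) :
  (sem e rho d -> typing (typof_env rho) e (typof d)) /\
  (typing Gamma e A -> sem e (eltof_env Gamma) (eltof A)).
Proof. by split; [exact: sem_typing | exact: typing_sem]. Qed.
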